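(* Let $\tau>0$, let $0\le\zeta\le\sqrt{3}$, and let $d$ be a real number such that $$d^2\le 2\zeta\Big(1-\frac{\zeta^2}{3}\Big).$$ Let $\theta_d$ be the local solution, on its maximal interval of existence $(0,T_d)$ with $T_d\le\infty$, of the initial value problem $$\theta''+\tau\theta'+\theta^2-1=0,\qquad \theta(0)=\zeta,\quad \theta'(0)=d .$$ Then $\theta_d$ is global, nonnegative, and tends to $1$ as $t$ approaches infinity.
   Context: The independent variable is $t\ge 0$ and primes denote $d/dt$. ''Global'' means $T_d=\infty$, i.e. the solution exists for all $t\ge 0$. *)

(* Defs.v *)
From Stdlib Require Import Reals.
From Coquelicot Require Import Coquelicot.
Open Scope R_scope.

(* The interval [0, T); the endpoint 0 is included so that the initial
   conditions make sense. *)
Definition Ico0 (T : Rbar) (t : R) : Prop := 0 <= t /\ Rbar_lt t T.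

(* Classical solution on [0, T). Derivatives are taken within [0, T)
   (Stdlib's [D_in]): two-sided for 0 < t < T, one-sided at 0; values of
   theta outside [0, T) are irrelevant. [theta1] and [theta2] are the first
   and second derivatives, uniquely determined on [0, T). *)
Definition solves_ivp (tau zeta d : R) (T : Rbar) (theta : R -> R) : Prop :=
  exists theta1 theta2 : R -> R,
    theta 0 = zeta /\ theta1 0 = d /\
    forall t : R, Ico0 T t ->
      D_in theta theta1 (Ico0 T) t /\
      D_in theta1 theta2 (Ico0 T) t /\
      theta2 t + tau * theta1 t + theta t ^ 2 - 1 = 0.

Definition maximal_solution (tau zeta d : R) (T : Rbar) (theta : R -> R)
    : Prop :=
  Rbar_lt 0 T /\
  solves_ivp tau zeta d T theta /\
  forall (T' : Rbar) (phi : R -> R),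
    solves_ivp tau zeta d T' phi ->
    (forall t : R, Ico0 T t -> Ico0 T' t /\ phi t = theta t) ->
    Rbar_le T' T.

(* Main.v *)
Require Import Defs.
From Stdlib Require Import Reals Lra Lia Psatz.
From Coquelicot Require Import Coquelicot.
Open Scope R_scope.

(** The energy [theta'^2 / 2 + theta^3 / 3 - theta] has derivative
    [- tau theta'^2], and the hypothesis on [d] says that it is nonpositive at
    [0]. It therefore stays nonpositive, which confines [theta] to
    [[0, sqrt 3]] and bounds [theta']. Power series give local solutions whose
    existence time depends only on such a bound, so a maximal solution is
    global. Adding a small multiple of [theta' (theta - 1)] to the energy
    turns it into a strict Lyapunov function for the equilibrium [(1, 0)],
    which decays exponentially; this uses [theta >= 0]. *)

(** * Power series and local existence *)

(** [tab n] is a total function that is already correct below [n], and the extensionality hypothesis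
    lets it stand in for the whole sequence. This form is needed because the Cauchy square makes
    each Taylor coefficient depend on all earlier ones. *)
Lemma course_of_values_recursion (F : nat -> (nat -> R) -> R) :
  (forall n a b, (forall k, (k < n)%nat -> a k = b k) -> F n a = F n b) ->
  exists a : nat -> R, forall n, a n = F n a.
Proof.
  intros Fext.
  set (tab := fix tab n : nat -> R :=
    match n with
    | O => fun _ => 0
    | S m => fun k => if Nat.eqb k m then F m (tab m) else tab m k
    end).
  assert (tabS : forall m k,
    tab (S m) k = if Nat.eqb k m then F m (tab m) else tab m k) by reflexivity.
  assert (tab_stable : forall n k, (k < n)%nat -> tab n k = tab (S k) k).
  { induction n as [|n IH]; intros k Hk; [lia|].
    destruct (Nat.eq_dec k n) as [->|Hkn]; [reflexivity|].
    rewrite tabS, (proj2 (Nat.eqb_neq k n) Hkn). apply IH; lia. }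
  exists (fun n => tab (S n) n). intros n.
  rewrite tabS, Nat.eqb_refl. apply Fext. exact (tab_stable n).
Qed.

Lemma CV_radius_geometric (a : nat -> R) (M C x : R) :
  0 < C -> (forall n, Rabs (a n) <= M * C ^ n) -> Rabs x < / C ->
  Rbar_lt (Rabs x) (CV_radius a).
Proof.
  intros HC Ha Hx.
  apply Rbar_lt_le_trans with (/ C); [exact Hx|].
  apply (CV_radius_bounded a). exists M. intros n.
  rewrite Rabs_mult, (Rabs_pos_eq ((/ C) ^ n)).
  - replace M with (M * C ^ n * (/ C) ^ n).
    + apply Rmult_le_compat_r; [|apply Ha].
      apply pow_le, Rlt_le, Rinv_0_lt_compat, HC.
    + rewrite Rmult_assoc, <- Rpow_mult_distr, Rinv_r, pow1 by lra. ring.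
  - apply pow_le, Rlt_le, Rinv_0_lt_compat, HC.
Qed.

Definition PS_one (n : nat) : R := match n with O => 1 | _ => 0 end.

Lemma ex_pseries_one (x : R) : ex_pseries PS_one x.
Proof.
  apply CV_radius_inside.
  (* Only the coefficient at 0 is nonzero, so any positive ratio works; this one puts [x] inside the
     disc. *)
  apply CV_radius_geometric with (M := 1) (C := / (Rabs x + 1)).
  - apply Rinv_0_lt_compat. pose proof (Rabs_pos x). lra.
  - assert (Hp : 0 < / (Rabs x + 1)).
    { apply Rinv_0_lt_compat. pose proof (Rabs_pos x). lra. }
    intros [|n]; simpl PS_one.
    + rewrite Rabs_R1. simpl. lra.
    + rewrite Rabs_R0. pose proof (pow_lt _ (S n) Hp). lra.
  - rewrite Rinv_inv. lra.
Qed.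

Lemma PSeries_one (x : R) : PSeries PS_one x = 1.
Proof.
  rewrite PSeries_decr_1 by apply ex_pseries_one.
  rewrite (PSeries_ext (PS_decr_1 PS_one) (fun _ => 0)) by reflexivity.
  rewrite PSeries_const_0. simpl. ring.
Qed.

(** Each of the [S n] products in the Cauchy sum has total exponent [S k + S (n - k) = S (S n)]. The
    factor [INR (S n)] is later cancelled by the denominator of the recursion. *)
Lemma Rabs_PS_mult_self_le (a : nat -> R) (C : R) (n : nat) :
  (forall k, (k <= n)%nat -> Rabs (a k) <= C ^ S k) ->
  Rabs (PS_mult a a n) <= INR (S n) * C ^ S (S n).
Proof.
  intros Ha. unfold PS_mult.
  eapply Rle_trans; [apply Rsum_abs|].
  eapply Rle_trans.
  - apply sum_Rle with (Bn := fun _ => C ^ S (S n)).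
    intros k Hk. rewrite Rabs_mult.
    replace (C ^ S (S n)) with (C ^ S k * C ^ S (n - k)).
    + apply Rmult_le_compat; try apply Rabs_pos; apply Ha; lia.
    + rewrite <- pow_add. f_equal. lia.
  - rewrite sum_cte. lra.
Qed.

(** The equation as a system in position and velocity. Derivatives are two-sided even at boundary
    points of [P], unlike those in [solves_ivp]. *)
Definition phase_flow (tau : R) (P : R -> Prop) (u v : R -> R) : Prop :=
  forall t, P t ->
    is_derive u t (v t) /\ is_derive v t (1 - tau * v t - u t ^ 2).

(** The recursion divides by [(n + 1) (n + 2)], which outweighs the growth of the linear and
    quadratic terms, so the bound [C ^ S n] reproduces itself. With exponent [S n] the same [C]
    bounds the initial data and gives the inverse radius of convergence. *)
Lemma power_series_coefficients (tau C a0 a1 : R) :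
  0 <= tau -> tau + 2 <= C -> Rabs a0 <= C -> Rabs a1 <= C ^ 2 ->
  exists a : nat -> R,
    a O = a0 /\ a 1%nat = a1 /\
    (forall n, PS_derive (PS_derive a) n =
       PS_one n - tau * PS_derive a n - PS_mult a a n) /\
    (forall n, Rabs (a n) <= C ^ S n).
Proof.
  intros Htau HC Ha0 Ha1.
  destruct (course_of_values_recursion (fun n a =>
    match n with
    | O => a0
    | S O => a1
    | S (S m) => (PS_one m - tau * PS_derive a m - PS_mult a a m)
                 / (INR (S m) * INR (S (S m)))
    end)) as [a Ha].
  { intros [|[|n]] a b Hab; try reflexivity.
    unfold PS_derive, PS_mult. rewrite (Hab (S n)) by lia.
    do 2 f_equal. apply sum_eq. intros k Hk.
    rewrite (Hab k), (Hab (n - k)%nat) by lia. reflexivity. }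
  exists a. split; [exact (Ha O)|]. split; [exact (Ha 1%nat)|].
  split.
  - intros n. unfold PS_derive at 1 2. rewrite (Ha (S (S n))).
    field. split; apply not_0_INR; lia.
  - assert (Hstrong : forall n k, (k <= n)%nat -> Rabs (a k) <= C ^ S k).
    2: { intros n. exact (Hstrong n n (le_n n)). }
    assert (HC1 : forall m, 1 <= C ^ m) by (intros m; apply pow_R1_Rle; lra).
    induction n as [|n IH]; intros k Hk.
    { replace k with O by lia. rewrite (Ha O). simpl. lra. }
    destruct (Nat.eq_dec k (S n)) as [->|Hkn]; [|apply IH; lia].
    destruct n as [|m]; [rewrite (Ha 1%nat); exact Ha1|].
    rewrite (Ha (S (S m))).
    assert (Hm : 1 <= INR (S m)) by (apply (le_INR 1); lia).
    assert (Hm2 : 1 <= INR (S (S m))) by (apply (le_INR 1); lia).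
    assert (Hsq : Rabs (PS_mult a a m) <= INR (S m) * C ^ S (S m)).
    { apply Rabs_PS_mult_self_le. intros k Hk'. apply IH; lia. }
    assert (Hone : Rabs (PS_one m) <= 1).
    { destruct m; simpl; [rewrite Rabs_R1|rewrite Rabs_R0]; lra. }
    assert (Hd : Rabs (tau * PS_derive a m) <= tau * (INR (S m) * C ^ S (S m))).
    { unfold PS_derive. rewrite !Rabs_mult, (Rabs_pos_eq tau), (Rabs_pos_eq (INR _)) by lra.
      apply Rmult_le_compat_l; [lra|]. apply Rmult_le_compat_l; [lra|].
      apply IH; lia. }
    rewrite Rabs_div, (Rabs_pos_eq (_ * _)) by nra.
    apply Rle_div_l; [nra|].
    assert (Hnum : Rabs (PS_one m - tau * PS_derive a m - PS_mult a a m)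
      <= 1 + tau * (INR (S m) * C ^ S (S m)) + INR (S m) * C ^ S (S m)).
    { eapply Rle_trans; [apply Rabs_triang|]. rewrite Rabs_Ropp.
      apply Rplus_le_compat; [|exact Hsq].
      eapply Rle_trans; [apply Rabs_triang|]. rewrite Rabs_Ropp. lra. }
    eapply Rle_trans; [exact Hnum|].
    change (C ^ S (S (S m))) with (C * C ^ S (S m)).
    pose proof (HC1 (S (S m))) as HX. set (X := C ^ S (S m)) in *.
    set (N := INR (S m)) in *. set (N' := INR (S (S m))) in *.
    (* This absorbs the constant 1: the numerator is at most [(tau + 2) * (N * X)], hence at most
       [C * (N * X)], and [1 <= N'] does the rest. *)
    assert (HNX : 1 <= N * X) by nra.
    apply Rle_trans with (C * (N * X)); [nra|].
    assert (0 <= C * (N * X)) by nra. nra.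
Qed.

(** The radius [/ C] depends on the data only through a bound on them, so it does not shrink along a
    bounded solution. *)
Lemma local_existence (tau C t0 a0 a1 : R) :
  0 <= tau -> tau + 2 <= C -> Rabs a0 <= C -> Rabs a1 <= C ^ 2 ->
  exists u v : R -> R,
    u t0 = a0 /\ v t0 = a1 /\ phase_flow tau (fun t => Rabs (t - t0) < / C) u v.
Proof.
  intros Htau HC Ha0 Ha1.
  destruct (power_series_coefficients tau C a0 a1 Htau HC Ha0 Ha1)
    as (a & E0 & E1 & Hrec & Hbound).
  exists (fun t => PSeries a (t - t0)), (fun t => PSeries (PS_derive a) (t - t0)).
  rewrite Rminus_diag, !PSeries_0.
  split; [exact E0|]. split; [unfold PS_derive; rewrite E1; simpl; ring|].
  intros t Ht.
  assert (Hr : Rbar_lt (Rabs (t - t0)) (CV_radius a)).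
  { apply CV_radius_geometric with (M := C) (C := C); [lra|exact Hbound|exact Ht]. }
  assert (Hr' : Rbar_lt (Rabs (t - t0)) (CV_radius (PS_derive a)))
    by (rewrite CV_radius_derive; exact Hr).
  set (x := t - t0) in *.
  assert (Hode : PSeries (PS_derive (PS_derive a)) x =
    1 - tau * PSeries (PS_derive a) x - PSeries a x ^ 2).
  { rewrite (PSeries_ext _
      (PS_minus (PS_minus PS_one (PS_scal tau (PS_derive a))) (PS_mult a a)) x Hrec).
    assert (Hs : ex_pseries (PS_scal tau (PS_derive a)) x).
    { apply ex_pseries_scal; [apply Rmult_comm|].
      apply ex_pseries_derive, Hr. }
    rewrite !PSeries_minus, PSeries_one, PSeries_scal, PSeries_mult; try assumption.
    - ring.
    - apply ex_pseries_one.
    - apply ex_pseries_minus; [apply ex_pseries_one|exact Hs].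
    - apply ex_pseries_mult; exact Hr. }
  split.
  - evar_last.
    + apply (is_derive_comp (PSeries a) (fun s => s - t0)).
      * apply is_derive_PSeries, Hr.
      * auto_derive; [exact I|reflexivity].
    + apply Rmult_1_l.
  - rewrite <- Hode. evar_last.
    + apply (is_derive_comp (PSeries (PS_derive a)) (fun s => s - t0)).
      * apply is_derive_PSeries, Hr'.
      * auto_derive; [exact I|reflexivity].
    + apply Rmult_1_l.
Qed.

(** * Monotonicity and uniqueness *)

(* [auto_derive] leaves the function under [Derive] eta-expanded. *)
Lemma Derive_eta (f : R -> R) (x l : R) :
  is_derive f x l -> Derive (fun y : R => f y) x = l.
Proof. exact (is_derive_unique f x l). Qed.

Lemma is_derive_continuity_pt (f : R -> R) (x l : R) :
  is_derive f x l -> continuity_pt f x.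
Proof.
  intros Hf. apply continuity_pt_filterlim, (ex_derive_continuous f).
  exists l. exact Hf.
Qed.

Lemma nonincreasing_of_derive (f df : R -> R) (a b : R) :
  a <= b ->
  (forall x, a < x < b -> is_derive f x (df x)) ->
  (forall x, a <= x <= b -> continuity_pt f x) ->
  (forall x, a <= x <= b -> df x <= 0) ->
  f b <= f a.
Proof.
  intros Hab Hd Hc Hneg.
  destruct (MVT_gen f a b df) as [c [Hc' Heq]];
    rewrite ?Rmin_left, ?Rmax_right in * by lra; try assumption.
  specialize (Hneg c Hc'). nra.
Qed.

(** Gronwall's argument: the squared distance between the two solutions, damped by
    [exp (- (K * t))], is nonincreasing and vanishes at [a]. *)
Lemma phase_flow_unique (tau a b : R) (u v p q : R -> R) :
  0 <= tau -> a <= b ->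
  phase_flow tau (fun t => a <= t <= b) u v ->
  phase_flow tau (fun t => a <= t <= b) p q ->
  u a = p a -> v a = q a -> u b = p b /\ v b = q b.
Proof.
  intros Htau Hab Huv Hpq Hu Hv.
  set (s2 := fun t => (u t + p t) ^ 2).
  destruct (continuity_ab_maj s2 a b Hab) as [m [Hm _]].
  { intros t Ht. unfold s2.
    destruct (Huv t Ht) as [Du _]. destruct (Hpq t Ht) as [Dp _].
    apply (is_derive_continuity_pt _ _ (2 * (v t + q t) * (u t + p t))).
    auto_derive.
    - repeat split; eexists; eassumption.
    - rewrite (Derive_eta _ _ _ Du), (Derive_eta _ _ _ Dp). ring. }
  (* The difference of the squares is [(u + p) * (u - p)], so a local Lipschitz constant is governed
     by the maximum of [(u + p) ^ 2]. The value [2 + s2 m] dominates [(1 + (1 - s) ^ 2) / 2] with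
     [s = u + p]. *)
  set (K := 2 + s2 m).
  set (F := fun t => ((u t - p t) ^ 2 + (v t - q t) ^ 2) * exp (- (K * t))).
  assert (HF : F b <= F a).
  { assert (DF : forall t, a <= t <= b -> is_derive F t
      ((2 * (u t - p t) * (v t - q t)
        + 2 * (v t - q t) * (- tau * (v t - q t) - (u t + p t) * (u t - p t))
        - K * ((u t - p t) ^ 2 + (v t - q t) ^ 2)) * exp (- (K * t)))).
    { intros t Ht. unfold F.
      destruct (Huv t Ht) as [Du Dv]. destruct (Hpq t Ht) as [Dp Dq].
      auto_derive.
      - repeat split; eexists; eassumption.
      - rewrite (Derive_eta _ _ _ Du), (Derive_eta _ _ _ Dp),
          (Derive_eta _ _ _ Dv), (Derive_eta _ _ _ Dq). ring. }
    eapply nonincreasing_of_derive; [exact Hab| | |].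
    - intros t Ht. apply DF. lra.
    - intros t Ht. eapply is_derive_continuity_pt, DF, Ht.
    - intros t Ht. cbv beta.
      pose proof (exp_pos (- (K * t))) as He. pose proof (Hm t Ht) as Hs.
      unfold K. unfold s2 in Hs at 1.
      set (w := u t - p t). set (z := v t - q t). set (s := u t + p t) in *.
      assert (2 * w * z * (1 - s) <= (2 + s2 m) * (w ^ 2 + z ^ 2)).
      { assert (2 * w * z * (1 - s) <= (1 + (1 - s) ^ 2) / 2 * (w ^ 2 + z ^ 2)).
        2: { assert ((1 + (1 - s) ^ 2) / 2 <= 2 + s2 m)
               by (pose proof (pow2_ge_0 (1 + s)); nra).
             eapply Rle_trans; [eassumption|].
             apply Rmult_le_compat_r; nra. }
        assert (Rabs (1 - s) <= (1 + (1 - s) ^ 2) / 2).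
        { apply Rabs_le. pose proof (pow2_ge_0 s). pose proof (pow2_ge_0 (2 - s)). lra. }
        assert (Rabs (2 * w * z) <= w ^ 2 + z ^ 2).
        { apply Rabs_le. pose proof (pow2_ge_0 (w - z)). pose proof (pow2_ge_0 (w + z)).
          lra. }
        eapply Rle_trans; [apply Rle_abs|]. rewrite Rabs_mult, Rmult_comm.
        apply Rmult_le_compat; auto using Rabs_pos. }
      assert (0 <= tau * z ^ 2) by (apply Rmult_le_pos; nra).
      rewrite <- (Rmult_0_l (exp (- (K * t)))).
      apply Rmult_le_compat_r; lra. }
  unfold F in HF. rewrite Hu, Hv, !Rminus_diag in HF.
  pose proof (exp_pos (- (K * b))).
  assert (Hz : (u b - p b) ^ 2 + (v b - q b) ^ 2 <= 0) by nra.
  pose proof (pow2_ge_0 (u b - p b)). pose proof (pow2_ge_0 (v b - q b)).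
  split; apply Rminus_diag_uniq, Rsqr_0_uniq; rewrite Rsqr_pow2; lra.
Qed.

(** * Energy and the trapping region *)

Definition energy (x y : R) : R := y ^ 2 / 2 + x ^ 3 / 3 - x.

(** The flow is required only on the open interval, with continuity up to its ends, so that [a = 0]
    is allowed, where a solution has just a one-sided derivative. *)
Lemma energy_nonincreasing (tau a b : R) (u v : R -> R) :
  0 <= tau -> a <= b ->
  (forall t, a <= t <= b -> continuity_pt u t /\ continuity_pt v t) ->
  phase_flow tau (fun t => a < t < b) u v ->
  energy (u b) (v b) <= energy (u a) (v a).
Proof.
  intros Htau Hab Hcont Huv.
  apply (nonincreasing_of_derive (fun t => energy (u t) (v t))
    (fun t => - tau * v t ^ 2)); unfold energy.
  - exact Hab.
  - intros t Ht. destruct (Huv t Ht) as [Du Dv]. auto_derive.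
    + repeat split; eexists; eassumption.
    + rewrite (Derive_eta _ _ _ Du), (Derive_eta _ _ _ Dv). field.
  - intros t Ht. destruct (Hcont t Ht) as [Cu Cv]. reg.
  - intros t _. pose proof (pow2_ge_0 (v t)). nra.
Qed.

(* On [energy <= 0] one has [x * (x^2 - 3) <= 0], so the value [x = -1]
   separates the component containing the initial data from the one with
   [x <= - sqrt 3]. *)
Lemma trapping_region (tau b : R) (u v : R -> R) :
  0 <= tau -> 0 <= b ->
  (forall t, 0 <= t <= b -> continuity_pt u t /\ continuity_pt v t) ->
  phase_flow tau (fun t => 0 < t < b) u v ->
  0 <= u 0 -> energy (u 0) (v 0) <= 0 ->
  0 <= u b <= 2 /\ Rabs (v b) <= 2.
Proof.
  intros Htau Hb Hcont Huv H0 HE0.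
  assert (HE : forall t, 0 <= t <= b -> energy (u t) (v t) <= 0).
  { intros t Ht. eapply Rle_trans; [|exact HE0].
    apply energy_nonincreasing with tau; [exact Htau|lra| |].
    - intros s Hs. apply Hcont. lra.
    - intros s Hs. apply Huv. lra. }
  assert (Hu : 0 <= u b).
  { destruct (Rle_lt_dec 0 (u b)) as [|Hneg]; [assumption|exfalso].
    pose proof (HE b (conj Hb (Rle_refl b))) as HEb. unfold energy in HEb.
    assert (Hb0 : 0 < b) by (destruct Hb as [|<-]; lra).
    (* The sign is flipped because the intermediate value theorem wants a negative value first. At
       [b], nonpositive energy and [u b < 0] force [u b ^ 2 >= 3], hence [u b < -1]. *)
    destruct (Ranalysis5.IVT_interv (fun t => - u t - 1) 0 b)
      as [s [Hs Hus]]; [ | exact Hb0 | lra | nra | ].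
    - intros t Ht. destruct (Hcont t Ht) as [Cu _]. reg.
    - pose proof (HE s Hs) as HEs. unfold energy in HEs.
      replace (u s) with (-1) in HEs by lra. nra. }
  pose proof (HE b (conj Hb (Rle_refl b))) as HEb. unfold energy in HEb.
  assert (Hu2 : u b <= 2).
  { destruct (Rle_lt_dec (u b) 2); [assumption|exfalso]. nra. }
  split; [lra|].
  apply Rabs_le. assert (v b ^ 2 <= 4) by nra. split; nra.
Qed.

(** * Exponential convergence to the equilibrium *)

Lemma Rabs_cross_term_le (e x y : R) :
  0 <= e <= / 2 -> Rabs (e * x * y) <= (x ^ 2 + y ^ 2) / 4.
Proof.
  intros He. rewrite Rmult_assoc, Rabs_mult, (Rabs_pos_eq e) by lra.
  assert (Hxy : Rabs (x * y) <= (x ^ 2 + y ^ 2) / 2).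
  { apply Rabs_le. pose proof (pow2_ge_0 (x - y)). pose proof (pow2_ge_0 (x + y)). lra. }
  pose proof (Rabs_pos (x * y)). nra.
Qed.

(** On [0 <= u <= 2] the function [G] is comparable to the squared distance from [(1, 0)], and its
    derivative is at most a negative multiple of that distance squared. Starting at time 1 avoids
    the one-sided derivative at 0. *)
Lemma exponential_decay (tau : R) (u v : R -> R) :
  0 < tau ->
  phase_flow tau (fun t => 1 <= t) u v ->
  (forall t, 1 <= t -> 0 <= u t <= 2) ->
  exists A k, 0 < k /\ forall t, 1 <= t -> (u t - 1) ^ 2 <= A * exp (- (k * t)).
Proof.
  intros Htau Huv Hu.
  (* [eps (1 + tau^2 / 2) <= tau / 2] lets the dissipation absorb the cross term
     [- eps tau y (x - 1)] in the derivative of [G]. *)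
  set (eps := tau / (2 * (1 + tau) ^ 2)).
  assert (Heq : 2 * eps * (1 + tau) ^ 2 = tau) by (unfold eps; field; lra).
  assert (Heps : 0 < eps) by (apply Rdiv_lt_0_compat; nra).
  assert (Heps2 : eps <= / 2) by nra.
  assert (Hepst : eps * (1 + tau ^ 2 / 2) <= tau / 2) by nra.
  assert (Hepst' : 2 * eps <= tau) by nra.
  (* With [w = x - 1], [energy x y + 2 / 3] equals [y ^ 2 / 2 + w ^ 2 * (w + 3) / 3]. *)
  set (G := fun x y => energy x y + 2 / 3 + eps * y * (x - 1)).
  (* The dissipation rate [eps / 2] divided by the constant 2 in the upper bound [HG] for [G]. *)
  set (k := eps / 4).
  set (H := fun t => G (u t) (v t) * exp (k * t)).
  assert (HH : forall t, 1 <= t -> H t <= H 1).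
  { intros t Ht.
    set (dH := fun t => (- tau * v t ^ 2
      + eps * (v t ^ 2 + (u t - 1) * (1 - tau * v t - u t ^ 2))
      + k * G (u t) (v t)) * exp (k * t)).
    assert (DH : forall s, 1 <= s -> is_derive H s (dH s)).
    { intros s Hs. unfold H, dH, G, energy. destruct (Huv s Hs) as [Du Dv].
      auto_derive.
      - repeat split; eexists; eassumption.
      - rewrite (Derive_eta _ _ _ Du), (Derive_eta _ _ _ Dv). field. }
    apply nonincreasing_of_derive with dH; [exact Ht| | |].
    - intros s Hs. apply DH. lra.
    - intros s Hs. eapply is_derive_continuity_pt, DH. lra.
    - intros s Hs. unfold dH. pose proof (exp_pos (k * s)) as He.
      assert (Hus := Hu s ltac:(lra)).
      set (w := u s - 1). set (y := v s).
      assert (HG : G (u s) y <= 2 * (y ^ 2 + w ^ 2)).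
      { unfold G, energy. replace (u s) with (w + 1) by (unfold w; ring).
        assert (w <= 1) by (unfold w; lra).
        pose proof (Rabs_cross_term_le eps y w ltac:(lra)) as Hc.
        apply Rabs_le_between in Hc.
        nra. }
      assert (HG' : - tau * y ^ 2 + eps * (y ^ 2 + w * (1 - tau * y - u s ^ 2))
        <= - (eps / 2) * (y ^ 2 + w ^ 2)).
      { replace (u s) with (w + 1) by (unfold w; ring).
        assert (-1 <= w) by (unfold w; lra).
        (* The restoring term is [w * (1 - (w + 1) ^ 2) = - w ^ 2 * (w + 2)]; nonnegativity of [u]
           keeps [w + 2] at least 1. *)
        assert (w ^ 2 <= w ^ 2 * (w + 2)) by nra.
        assert (- (tau * y * w) <= w ^ 2 / 2 + tau ^ 2 * y ^ 2 / 2).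
        { pose proof (pow2_ge_0 (w + tau * y)). nra. }
        assert (w * (1 - tau * y - (w + 1) ^ 2) <= - w ^ 2 / 2 + tau ^ 2 * y ^ 2 / 2)
          by nra.
        assert (eps * (1 + tau ^ 2 / 2) * y ^ 2 <= tau / 2 * y ^ 2)
          by (apply Rmult_le_compat_r; [apply pow2_ge_0|exact Hepst]).
        assert (eps * y ^ 2 <= tau / 2 * y ^ 2)
          by (apply Rmult_le_compat_r; [apply pow2_ge_0|lra]).
        assert (eps * (w * (1 - tau * y - (w + 1) ^ 2)) <=
          eps * (- w ^ 2 / 2 + tau ^ 2 * y ^ 2 / 2))
          by (apply Rmult_le_compat_l; lra).
        nra. }
      assert (k * G (u s) y <= eps / 2 * (y ^ 2 + w ^ 2)) by (unfold k; nra).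
      fold w y. rewrite <- (Rmult_0_l (exp (k * s))).
      apply Rmult_le_compat_r; lra. }
  exists (4 * H 1), k. split; [unfold k; lra|].
  intros t Ht. pose proof (HH t Ht) as Hle. unfold H at 1 in Hle.
  assert (Hus := Hu t Ht).
  assert (HG : (u t - 1) ^ 2 <= 4 * G (u t) (v t)).
  { unfold G, energy. set (w := u t - 1). set (y := v t).
    replace (u t) with (w + 1) by (unfold w; ring).
    assert (-1 <= w) by (unfold w; lra).
    pose proof (Rabs_cross_term_le eps y w ltac:(lra)) as Hc.
    apply Rabs_le_between in Hc.
    nra. }
  apply Rmult_le_reg_r with (exp (k * t)); [apply exp_pos|].
  rewrite (Rmult_assoc (4 * H 1)), <- exp_plus, Rplus_opp_l, exp_0.
  pose proof (exp_pos (k * t)). nra.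
Qed.

Lemma is_lim_of_exponential_decay (f : R -> R) (l A k : R) :
  0 < k -> (forall t, 1 <= t -> (f t - l) ^ 2 <= A * exp (- (k * t))) ->
  is_lim f p_infty l.
Proof.
  intros Hk Hf.
  assert (Hexp : is_lim (fun t => A * exp (- (k * t))) p_infty 0).
  { evar_last.
    - apply is_lim_scal_l, is_lim_comp with m_infty.
      + apply is_lim_exp_m.
      + apply (is_lim_ext (fun t => (- k) * t)); [intros; ring|].
        evar_last; [apply is_lim_scal_l, is_lim_id|].
        simpl. destruct (Rle_dec 0 (- k)); [exfalso; lra|reflexivity].
      + exists 0. discriminate.
    - simpl. f_equal. ring. }
  apply is_lim_spec in Hexp. apply is_lim_spec. intros eps.
  destruct (Hexp (mkposreal (eps ^ 2) (pow_lt _ 2 (cond_pos eps)))) as [M HM].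
  exists (Rmax M 1). intros t Ht.
  pose proof (Rmax_l M 1). pose proof (Rmax_r M 1).
  specialize (HM t ltac:(lra)). specialize (Hf t ltac:(lra)). simpl in HM.
  apply Rabs_def2 in HM. pose proof (cond_pos eps).
  apply Rabs_def1; nra.
Qed.

(** * Derivatives within a half-open interval *)

(** A derivative within a set is a local notion. This one statement covers shrinking the domain,
    altering the function away from the point, and gluing. *)
Lemma D_in_transfer (f df g dg : R -> R) (D D' : R -> Prop) (x delta : R) :
  0 < delta ->
  (forall y, D' y -> Rabs (y - x) < delta -> D y /\ g y = f y) ->
  g x = f x -> dg x = df x ->
  D_in f df D x -> D_in g dg D' x.
Proof.
  intros Hdelta Hloc Hg Hdg Hf eps Heps.
  destruct (Hf eps Heps) as (alp & Halp & Hlim).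
  exists (Rmin alp delta). split; [apply Rmin_glb_lt; assumption|].
  intros y [[Hy Hyx] Hdist]. simpl in Hdist. unfold Rdist in Hdist.
  pose proof (Rmin_l alp delta). pose proof (Rmin_r alp delta).
  destruct (Hloc y Hy ltac:(lra)) as [HDy Hgy].
  rewrite Hg, Hdg, Hgy. apply Hlim. split; [split; assumption|].
  simpl. unfold Rdist. lra.
Qed.

Lemma Rbar_lt_neighborhood (T : Rbar) (t : R) :
  Rbar_lt t T -> exists delta, 0 < delta /\ forall y, y < t + delta -> Rbar_lt y T.
Proof.
  destruct T as [T| |]; simpl; intros HT.
  - exists (T - t). split; [lra|]. intros y. lra.
  - exists 1. split; [lra|trivial].
  - contradiction.
Qed.

Lemma D_in_Ico0_is_derive (T : Rbar) (f df : R -> R) (t : R) :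
  0 < t -> Rbar_lt t T -> D_in f df (Ico0 T) t -> is_derive f t (df t).
Proof.
  intros Ht HtT Hf. apply is_derive_Reals, derivable_pt_lim_D_in.
  destruct (Rbar_lt_neighborhood T t HtT) as (delta & Hdelta & HT).
  apply D_in_transfer with (f := f) (df := df) (D := Ico0 T) (delta := Rmin t delta);
    try reflexivity; [apply Rmin_glb_lt; assumption| |exact Hf].
  intros y _ Hy. pose proof (Rmin_l t delta). pose proof (Rmin_r t delta).
  apply Rabs_def2 in Hy. split; [|reflexivity].
  split; [lra|]. apply HT. lra.
Qed.

Lemma is_derive_D_in (f df : R -> R) (D : R -> Prop) (t : R) :
  is_derive f t (df t) -> D_in f df D t.
Proof.
  intros Hf. apply is_derive_Reals, derivable_pt_lim_D_in in Hf.
  apply D_in_transfer with (f := f) (df := df) (D := no_cond) (delta := 1);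
    try reflexivity; [lra| |exact Hf].
  intros y _ _. split; [exact I|reflexivity].
Qed.

Lemma is_derive_Rmax0 (f : R -> R) (t l : R) :
  0 < t -> is_derive f t l -> is_derive (fun s => f (Rmax 0 s)) t l.
Proof.
  intros Ht. apply is_derive_ext_loc.
  exists (mkposreal t Ht). intros y Hy. apply Rabs_def2 in Hy. simpl in Hy.
  rewrite Rmax_right; [reflexivity|].
  unfold minus, plus, opp in Hy. simpl in Hy. lra.
Qed.

(** Composing with [Rmax 0] freezes the function at its initial value for negative times, which
    makes continuity at 0 two-sided, as [trapping_region] requires. *)
Lemma D_in_Ico0_continuity_Rmax0 (T : Rbar) (f df : R -> R) (t : R) :
  Ico0 T t -> D_in f df (Ico0 T) t -> continuity_pt (fun s => f (Rmax 0 s)) t.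
Proof.
  intros [Ht HtT] Hf. destruct (Rle_lt_or_eq_dec 0 t Ht) as [Hpos|Heq].
  - apply is_derive_continuity_pt with (df t).
    apply is_derive_Rmax0; [exact Hpos|].
    apply D_in_Ico0_is_derive with T; assumption.
  - subst t. apply cont_deriv in Hf.
    destruct (Rbar_lt_neighborhood T 0 HtT) as (delta & Hdelta & HT).
    intros eps Heps. destruct (Hf eps Heps) as (alp & Halp & Hlim).
    exists (Rmin alp delta). split; [apply Rmin_glb_lt; assumption|].
    intros y [_ Hy]. simpl in Hy |- *. unfold Rdist in Hy |- *.
    pose proof (Rmin_l alp delta). pose proof (Rmin_r alp delta).
    rewrite (Rmax_left 0 0) by lra.
    destruct (Rle_lt_dec y 0) as [Hle|Hlt].
    + rewrite Rmax_left, Rminus_diag, Rabs_R0 by lra. exact Heps.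
    + rewrite Rmax_right by lra. apply Rabs_def2 in Hy as Hy'.
      apply Hlim. split.
      * split; [split; [lra|apply HT; lra]|lra].
      * simpl. unfold Rdist. lra.
Qed.

(** * Bounds and continuation of solutions *)

Definition solves_system (tau : R) (T : Rbar) (theta theta1 : R -> R) : Prop :=
  forall t, Ico0 T t ->
    D_in theta theta1 (Ico0 T) t /\
    D_in theta1 (fun s => 1 - tau * theta1 s - theta s ^ 2) (Ico0 T) t.

Lemma solves_ivp_system (tau zeta d : R) (T : Rbar) (theta : R -> R) :
  solves_ivp tau zeta d T theta <->
  exists theta1, theta 0 = zeta /\ theta1 0 = d /\ solves_system tau T theta theta1.
Proof.
  split.
  - intros (theta1 & theta2 & H0 & H1 & Hode). exists theta1.
    split; [exact H0|]. split; [exact H1|].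
    intros t Ht. destruct (Hode t Ht) as (D1 & D2 & E).
    split; [exact D1|].
    apply D_in_transfer with (f := theta1) (df := theta2) (D := Ico0 T) (delta := 1);
      try reflexivity; [lra|intros; split; [assumption|reflexivity]|lra|exact D2].
  - intros (theta1 & H0 & H1 & Hode).
    exists theta1, (fun s => 1 - tau * theta1 s - theta s ^ 2).
    split; [exact H0|]. split; [exact H1|].
    intros t Ht. destruct (Hode t Ht) as (D1 & D2).
    split; [exact D1|]. split; [exact D2|]. ring.
Qed.

Lemma solves_system_phase_flow (tau : R) (T : Rbar) (theta theta1 : R -> R) :
  solves_system tau T theta theta1 ->
  phase_flow tau (fun t => 0 < t /\ Rbar_lt t T) theta theta1.
Proof.
  intros Hs t [Ht HtT].
  destruct (Hs t (conj (Rlt_le _ _ Ht) HtT)) as [D1 D2].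
  split.
  - exact (D_in_Ico0_is_derive T _ _ t Ht HtT D1).
  - exact (D_in_Ico0_is_derive T _ _ t Ht HtT D2).
Qed.

Lemma solves_system_bounds (tau : R) (T : Rbar) (theta theta1 : R -> R) :
  0 <= tau -> solves_system tau T theta theta1 ->
  0 <= theta 0 -> energy (theta 0) (theta1 0) <= 0 ->
  forall t, Ico0 T t -> 0 <= theta t <= 2 /\ Rabs (theta1 t) <= 2.
Proof.
  intros Htau Hs H0 HE t [Ht HtT].
  assert (HIco : forall s, 0 <= s <= t -> Ico0 T s).
  { intros s Hst. split; [lra|]. apply Rbar_le_lt_trans with t; [simpl; lra|exact HtT]. }
  replace t with (Rmax 0 t) by (apply Rmax_right; exact Ht).
  apply (trapping_region tau t
    (fun s => theta (Rmax 0 s)) (fun s => theta1 (Rmax 0 s))); try assumption.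
  - intros s Hst. destruct (Hs s (HIco s Hst)) as [D1 D2].
    split; eapply D_in_Ico0_continuity_Rmax0; eauto.
  - intros s Hst.
    destruct (solves_system_phase_flow tau T theta theta1 Hs s) as [D1 D2].
    { split; [lra|]. apply HIco. lra. }
    rewrite (Rmax_right 0 s) by lra.
    split; apply is_derive_Rmax0; assumption || lra.
  - rewrite Rmax_left by lra. exact H0.
  - rewrite Rmax_left by lra. exact HE.
Qed.

(* The local solution is started at a time [t0] before [T] rather than at [T]:
   its existence time depends only on the bound, so it passes [T], and
   uniqueness on the overlap [t0, T) makes the glued function smooth at [T]. *)
Lemma solves_system_extension (tau T : R) (theta theta1 : R -> R) :
  0 <= tau -> 0 < T -> solves_system tau T theta theta1 ->
  (forall t, Ico0 T t -> Rabs (theta t) <= 2 /\ Rabs (theta1 t) <= 2) ->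
  exists (T' : R) (phi phi1 : R -> R),
    T < T' /\ solves_system tau T' phi phi1 /\
    forall t, t < T -> phi t = theta t /\ phi1 t = theta1 t.
Proof.
  intros Htau HT Hs Hb.
  set (C := tau + 2).
  assert (HC : 0 < / C) by (apply Rinv_0_lt_compat; unfold C; lra).
  (* The bound [h <= T / 2] keeps [t0] positive, and [h <= / C / 2] makes [t0 + / C] exceed [T]. *)
  set (h := Rmin T (/ C) / 2). set (t0 := T - h).
  assert (Hh : 0 < h /\ h <= T / 2 /\ h <= / C / 2).
  { pose proof (Rmin_l T (/ C)). pose proof (Rmin_r T (/ C)).
    pose proof (Rmin_glb_lt T (/ C) 0 HT HC). unfold h. lra. }
  assert (Ht0 : 0 < t0 < T) by (unfold t0; lra).
  destruct (Hb t0) as [B0 B1]; [split; simpl; lra|].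
  destruct (local_existence tau C t0 (theta t0) (theta1 t0))
    as (u & v & Hu & Hv & Huv); [exact Htau|unfold C; lra|unfold C; lra|unfold C; nra|].
  pose proof (solves_system_phase_flow tau T theta theta1 Hs) as Hflow.
  assert (Hagree : forall t, t0 <= t < T -> u t = theta t /\ v t = theta1 t).
  { intros t Ht.
    apply phase_flow_unique with (tau := tau) (a := t0); try assumption; try lra.
    - intros s Hst. apply Huv. apply Rabs_def1; unfold t0 in *; lra.
    - intros s Hst. apply Hflow. split; simpl; lra. }
  set (glue := fun (f g : R -> R) t => if Rlt_dec t T then f t else g t).
  assert (glue_l : forall f g t, t < T -> glue f g t = f t).
  { intros f g t Ht. unfold glue. destruct (Rlt_dec t T); [reflexivity|lra]. }
  assert (glue_r : forall f g t, T <= t -> glue f g t = g t).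
  { intros f g t Ht. unfold glue. destruct (Rlt_dec t T); [lra|reflexivity]. }
  exists (t0 + / C), (glue theta u), (glue theta1 v).
  split; [unfold t0; lra|]. split; [|auto].
  intros t [Ht HtT']. simpl in HtT'.
  destruct (Rlt_le_dec t T) as [HtT|HtT].
  - destruct (Hs t (conj Ht HtT)) as [D1 D2].
    split; [apply D_in_transfer with (3 := glue_l theta u t HtT) (5 := D1)
        (delta := T - t)
      |apply D_in_transfer with (3 := glue_l theta1 v t HtT) (5 := D2)
        (delta := T - t)];
      try lra; try (rewrite !glue_l by lra; reflexivity);
      intros y [Hy _] Hyt; apply Rabs_def2 in Hyt;
      (split; [split; simpl; lra|apply glue_l; lra]).
  - destruct (Huv t) as [D1 D2]; [apply Rabs_def1; unfold t0 in *; lra|].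
    apply (is_derive_D_in u v no_cond) in D1.
    apply (is_derive_D_in v (fun s => 1 - tau * v s - u s ^ 2) no_cond) in D2.
    (* Since [T <= t], the ball of radius [h] around [t] lies to the right of [t0], where both
       branches of the glued function agree with the local solution. *)
    assert (Hloc : forall y, Rabs (y - t) < h ->
      glue theta u y = u y /\ glue theta1 v y = v y).
    { intros y Hy. apply Rabs_def2 in Hy. destruct (Rlt_le_dec y T) as [HyT|HyT].
      - rewrite !glue_l by exact HyT.
        destruct (Hagree y) as [E1 E2]; [unfold t0; lra|]. auto.
      - rewrite !glue_r by exact HyT. auto. }
    split; [apply D_in_transfer with (3 := glue_r theta u t HtT) (5 := D1)
        (delta := h)
      |apply D_in_transfer with (3 := glue_r theta1 v t HtT) (5 := D2)
        (delta := h)];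
      try lra; try (rewrite !glue_r by lra; reflexivity);
      intros y _ Hy; (split; [exact I|apply Hloc, Hy]).
Qed.

Theorem theorem3p1 (tau zeta d : R) (T : Rbar) (theta : R -> R)
    (htau : 0 < tau) (hzeta : 0 <= zeta <= sqrt 3)
    (hd : d ^ 2 <= 2 * zeta * (1 - zeta ^ 2 / 3))
    (hmax : maximal_solution tau zeta d T theta) :
  T = p_infty /\
  (forall t : R, 0 <= t -> 0 <= theta t) /\
  is_lim theta p_infty 1.
Proof.
  destruct hmax as (HT0 & Hivp & Hmax).
  apply solves_ivp_system in Hivp as (theta1 & E0 & E1 & Hs).
  assert (Hbounds := solves_system_bounds tau T theta theta1 ltac:(lra) Hs).
  rewrite E0, E1 in Hbounds.
  specialize (Hbounds (proj1 hzeta) ltac:(unfold energy; nra)).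
  assert (HT : T = p_infty).
  { destruct T as [T| |]; [exfalso|reflexivity|contradiction].
    destruct (solves_system_extension tau T theta theta1)
      as (T' & phi & phi1 & HTT' & Hphi & Hagree);
      [lra|exact HT0|exact Hs| |].
    { intros t Ht. destruct (Hbounds t Ht) as [Hu Hv].
      split; [|exact Hv]. rewrite Rabs_pos_eq; lra. }
    simpl in HT0.
    (* Maximality, applied to the longer solution [phi], would give [T' <= T]. *)
    apply (Rlt_not_le _ _ HTT'), (Hmax T' phi).
    - apply solves_ivp_system. exists phi1.
      destruct (Hagree 0 HT0) as [-> ->]. auto.
    - intros t [Ht HtT]. simpl in HtT.
      split; [split; simpl; lra|apply Hagree, HtT]. }
  subst T.
  assert (Hu : forall t, 0 <= t -> 0 <= theta t <= 2).
  { intros t Ht. apply Hbounds. split; [exact Ht|exact I]. }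
  split; [reflexivity|]. split; [intros t Ht; apply Hu, Ht|].
  destruct (exponential_decay tau theta theta1) as (A & k & Hk & Hdecay).
  - exact htau.
  - intros t Ht. apply (solves_system_phase_flow tau p_infty); [exact Hs|].
    split; [lra|exact I].
  - intros t Ht. apply Hu. lra.
  - exact (is_lim_of_exponential_decay theta 1 A k Hk Hdecay).
Qed.
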